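(* Any Albert extension of $C_3$ by $C_2$ is isomorphic to one of the following twelve pairwise non-isomorphic loops $\mathcal{L}(\epsilon,\tau,\theta,q)$: $$\mathcal{L}(0,0,0,0),\ \mathcal{L}(0,0,1,0),\ \mathcal{L}(0,0,1,1),\ \mathcal{L}(0,1,0,0),\ \mathcal{L}(0,1,0,1),\ \mathcal{L}(0,1,1,0),$$ $$\mathcal{L}(1,0,0,0),\ \mathcal{L}(1,0,0,1),\ \mathcal{L}(1,0,1,0),\ \mathcal{L}(1,1,0,0),\ \mathcal{L}(1,1,1,0),\ \mathcal{L}(1,1,1,1).$$ $\mathcal{L}(0,0,0,0)$ is isomorphic to the cyclic group $C_6$, $\mathcal{L}(0,0,1,0)$ is isomorphic to the dihedral group $D_3$ (of order $6$), and $\mathcal{L}(0,0,1,1)$ is a non-associative nuclear extension. The others are non-associative loops in which $\{0\}\times C_3$ is not nuclear. Among the twelve loops only $\mathcal{L}(1,1,0,0)$, which is middle nuclear, is both non-associative and commutative.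
   Context: $C_2=\{0,1\}$ is the cyclic group of order two and $C_3$ is identified with the additive group of the field $\mathbb{F}_3$. For $\xi\in C_2=\{0,1\}$, $\xi'\in\mathbb{F}_3$ denotes the corresponding element $0$ or $1$ of $\mathbb{F}_3$. For $\epsilon,\tau,\theta,q\in\{0,1\}\subset\mathbb{F}_3$ (in this order of arguments), $\mathcal{L}(\epsilon,\tau,\theta,q)$ is the loop on $C_2\times C_3$ with multiplication $$(\alpha,a)(\beta,b)=\big(\alpha+\beta,\ \alpha'\beta'(q+\epsilon(1+\theta)a+\tau b)+(1+\beta'\theta)a+b\big),$$ arithmetic in the second coordinate being in $\mathbb{F}_3$. The left, middle and right nuclei of a loop are $\{u: ux\cdot y=u\cdot xy\ \forall x,y\}$, $\{u: xu\cdot y=x\cdot uy\ \forall x,y\}$ and $\{u: xy\cdot u=x\cdot yu\ \forall x,y\}$; the nucleus is their intersection. The extension is (middle) nuclear if $\{0\}\times C_3$ is contained in the (middle) nucleus. For loops $K,N$ with identities $1_K,e$, an Albert extension of $N$ by $K$ is a loop on $K\times N$ with multiplication $(\alpha,a)(\beta,b)=(\alpha\beta,\triangledown_{\alpha,\beta}(a,b))$, where $\triangledown_{\alpha,\beta}$ are quasigroup multiplications on $N$ such that $\triangledown_{1_K,1_K}$ is the multiplication of $N$, $e$ is a left identity of $\triangledown_{1_K,\alpha}$ and $e$ is a two-sided identity of $\triangledown_{\alpha,1_K}$ for all $\alpha\in K$. Here $N=C_3$, $K=C_2$. *)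

(* Defs.v *)
From mathcomp Require Import all_boot all_fingroup all_algebra all_solvable.

Set Implicit Arguments.
Unset Strict Implicit.
Unset Printing Implicit Defensive.

Import GRing.Theory.
Local Open Scope ring_scope.

Definition quasigroup (T : Type) (op : T -> T -> T) : Prop :=
  (forall a b, exists! x, op a x = b) /\ (forall a b, exists! y, op y a = b).

Definition loop_law (T : Type) (op : T -> T -> T) (one : T) : Prop :=
  [/\ quasigroup op, left_id one op & right_id one op].

Definition loop_isomorphic (S T : Type)
    (opS : S -> S -> S) (opT : T -> T -> T) : Prop :=
  exists f : S -> T, bijective f /\ {morph f : x y / opS x y >-> opT x y}.

Definition left_nucleus (T : Type) (op : T -> T -> T) (u : T) : Prop :=
  forall x y, op (op u x) y = op u (op x y).

Definition middle_nucleus (T : Type) (op : T -> T -> T) (u : T) : Prop :=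
  forall x y, op (op x u) y = op x (op u y).

Definition right_nucleus (T : Type) (op : T -> T -> T) (u : T) : Prop :=
  forall x y, op (op x y) u = op x (op y u).

Definition nucleus (T : Type) (op : T -> T -> T) (u : T) : Prop :=
  [/\ left_nucleus op u, middle_nucleus op u & right_nucleus op u].

(* Extension of the loop (N, opN, e) by the loop (K, opK, oneK). *)
Definition albert_extension (K N : Type) (opK : K -> K -> K) (oneK : K)
    (opN : N -> N -> N) (e : N) (op : K * N -> K * N -> K * N) : Prop :=
  [/\ loop_law opK oneK,
      loop_law opN e,
      exists one, loop_law op one
    & exists nabla : K -> K -> N -> N -> N,
        [/\ forall x y, op x y = (opK x.1 y.1, nabla x.1 y.1 x.2 y.2),
            forall alpha beta, quasigroup (nabla alpha beta),
            forall a b, nabla oneK oneK a b = opN a b,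
            forall alpha, left_id e (nabla oneK alpha)
          & forall alpha, left_id e (nabla alpha oneK) /\
                          right_id e (nabla alpha oneK)]].

Definition nuclear (K N : Type) (oneK : K)
    (op : K * N -> K * N -> K * N) : Prop :=
  forall a : N, nucleus op (oneK, a).

Definition middle_nuclear (K N : Type) (oneK : K)
    (op : K * N -> K * N -> K * N) : Prop :=
  forall a : N, middle_nucleus op (oneK, a).

Definition albert_ext_C3_C2 (op : 'Z_2 * 'F_3 -> 'Z_2 * 'F_3 -> 'Z_2 * 'F_3) :
    Prop :=
  albert_extension +%R 0 +%R 0 op.

Definition prime2 (xi : 'Z_2) : 'F_3 := (xi : nat)%:R.

(* The parameters are meant to range over {0, 1} only; for other values in F_3 *)
(* the operation need not be a loop.                                          *)
Definition Lmul (epsilon tau theta q : 'F_3) (x y : 'Z_2 * 'F_3) :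
    'Z_2 * 'F_3 :=
  let: (alpha, a) := x in
  let: (beta, b) := y in
  (alpha + beta,
   prime2 alpha * prime2 beta * (q + epsilon * (1 + theta) * a + tau * b)
     + (1 + prime2 beta * theta) * a + b).

Definition L (p : 'F_3 * 'F_3 * 'F_3 * 'F_3) :
    'Z_2 * 'F_3 -> 'Z_2 * 'F_3 -> 'Z_2 * 'F_3 :=
  let: (epsilon, tau, theta, q) := p in Lmul epsilon tau theta q.

Definition twelve : seq ('F_3 * 'F_3 * 'F_3 * 'F_3) :=
  [:: (0, 0, 0, 0); (0, 0, 1, 0); (0, 0, 1, 1); (0, 1, 0, 0);
      (0, 1, 0, 1); (0, 1, 1, 0); (1, 0, 0, 0); (1, 0, 0, 1);
      (1, 0, 1, 0); (1, 1, 0, 0); (1, 1, 1, 0); (1, 1, 1, 1)].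

(* Main.v *)
(* Over F_3 every quasigroup operation is affine, a * b = i a + j b + c with
   i, j nonzero, so an Albert extension of C_3 by C_2 is given by three signs
   i, k, l and a constant c:
     (0,a)(1,b) = (1, i a + b)   and   (1,a)(1,b) = (0, k a + l b + c).
   An isomorphism f between two such loops preserves the first coordinate, as
   there is no nonzero homomorphism from C_3 to C_2, hence is of the form
   (0,a) |-> (0, s a), (1,a) |-> (1, s a + t) with s nonzero. Such a map exists
   if and only if the signs agree and c' = s c - (k + l) t. Thus c can be
   normalized to 0 when k = l, and to 0 or 1 when k = - l, which leaves
   2 * (2 + 2 * 2) = 12 classes. *)

Require Import Defs.
From mathcomp Require Import all_boot all_fingroup all_algebra all_solvable.
From mathcomp Require Import ring.
Import GRing.Theory.
Local Open Scope ring_scope.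

(** * Arithmetic in F_3 and Z_2 *)

Lemma F3_mem (x : 'F_3) : x \in [:: 0; 1; -1].
Proof. by case: x => [[|[|[|]]]]. Qed.

Lemma F3_neq0_mem {x : 'F_3} : x != 0 -> x \in [:: 1; -1].
Proof. by case: x => [[|[|[|]]]]. Qed.

Lemma F3_sum_distinct (x y z : 'F_3) :
  x != y -> x != z -> y != z -> x + y + z = 0.
Proof.
move=> xy xz yz; apply/eqP; move: xy xz yz.
by case: x => [[|[|[|]]]] //; case: y => [[|[|[|]]]] //; case: z => [[|[|[|]]]].
Qed.

Lemma Z2_mem (x : 'Z_2) : x \in [:: 0; 1].
Proof. by case: x => [[|[|]]]. Qed.

Lemma Z2_ind (P : 'Z_2 -> Prop) : P 0 -> P 1 -> forall x, P x.
Proof. by move=> P0 P1 x; move: (Z2_mem x); rewrite !inE => /pred2P[] ->. Qed.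

(** The values at 0 and 1 determine the third one, since three distinct elements of F_3 sum to 0. *)
Lemma F3_inj_affine {h : 'F_3 -> 'F_3} :
  injective h -> forall x, h x = (h 1 - h 0) * x + h 0.
Proof.
move=> inj_h x; move: (F3_mem x); rewrite !inE => /or3P[] /eqP->.
- by rewrite mulr0 add0r.
- by rewrite mulr1 subrK.
have /eqP : h 0 + h 1 + h (-1) = 0 by apply: F3_sum_distinct; rewrite inj_eq.
rewrite addrC addr_eq0 => /eqP->.
have h0_2 : h 0 + h 0 = - h 0.
  by apply/eqP; case: (h 0) => [[|[|[|]]]].
by ring: h0_2.
Qed.

(** * Quasigroups, and their affine form over F_3 *)

Lemma quasigroup_injl {T : Type} {op : T -> T -> T} a :
  quasigroup op -> injective (op a).
Proof.
case=> div _ x y opxy; have [z [_ uz]] := div a (op a y).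
by rewrite -(uz x) // (uz y).
Qed.

Lemma quasigroup_injr {T : Type} {op : T -> T -> T} b :
  quasigroup op -> injective (op^~ b).
Proof.
case=> _ div x y opxy; have [z [_ uz]] := div b (op y b).
by rewrite -(uz x) // (uz y).
Qed.

(** An equation is solved in the first coordinate, which then selects the quasigroup in which to
    solve for the second. *)
Lemma quasigroup_ext {S T : Type} (opS : S -> S -> S)
    (nabla : S -> S -> T -> T -> T) :
    quasigroup opS -> (forall s t, quasigroup (nabla s t)) ->
  quasigroup (fun x y : S * T => (opS x.1 y.1, nabla x.1 y.1 x.2 y.2)).
Proof.
move=> qS qT; split=> -[s a] [t b] /=.
- have [u [su uu]] := qS.1 s t; have [x [ax ux]] := (qT s u).1 a b.
  by exists (u, x); split=> [|[u' x'] /= [/uu <- /ux <-]] //=; rewrite su ax.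
- have [u [su uu]] := qS.2 s t; have [x [ax ux]] := (qT u s).2 a b.
  by exists (u, x); split=> [|[u' x'] /= [/uu <- /ux <-]] //=; rewrite su ax.
Qed.

Lemma affine_quasigroup {F : fieldType} (i j c : F) (op : F -> F -> F) :
    i != 0 -> j != 0 -> (forall a b, op a b = i * a + j * b + c) ->
  quasigroup op.
Proof.
move=> i0 j0 opE; split=> a b.
- by exists ((b - c - i * a) / j); split=> [|x <-]; rewrite opE; field.
- by exists ((b - c - j * a) / i); split=> [|x <-]; rewrite opE; field.
Qed.

(* If the slopes of two rows differed, the rows would agree somewhere. *)
Lemma F3_quasigroup_affine (op : 'F_3 -> 'F_3 -> 'F_3) :
    quasigroup op ->
  exists i j c, [/\ i != 0, j != 0 & forall a b, op a b = i * a + j * b + c].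
Proof.
move=> qop; pose j a := op a 1 - op a 0.
have rowE a b : op a b = j a * b + op a 0.
  exact: (F3_inj_affine (quasigroup_injl a qop)).
have j_const a : j a = j 0.
  apply/eqP; apply/negPn/negP => neq_j.
  have neq_ja : j a - j 0 != 0 by rewrite subr_eq0.
  have eq_op : op a ((op 0 0 - op a 0) / (j a - j 0))
             = op 0 ((op 0 0 - op a 0) / (j a - j 0)).
    by rewrite [LHS]rowE [RHS]rowE; field.
  by move: neq_j; rewrite (quasigroup_injr _ qop _ _ eq_op) eqxx.
exists (op 1 0 - op 0 0), (j 0), (op 0 0); split.
- by rewrite subr_eq0 (inj_eq (quasigroup_injr 0 qop)).
- by rewrite subr_eq0 (inj_eq (quasigroup_injl 0 qop)).
move=> a b; rewrite rowE j_const.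
by rewrite (F3_inj_affine (quasigroup_injr 0 qop) a); ring.
Qed.

(** * Normal form of the Albert extensions *)

Definition sign_nabla (i k l c : 'F_3) (al be : 'Z_2) (a b : 'F_3) : 'F_3 :=
  if al == 0 then (if be == 0 then a + b else i * a + b)
  else if be == 0 then a + b else k * a + l * b + c.

Definition sign_ext (i k l c : 'F_3) (x y : 'Z_2 * 'F_3) : 'Z_2 * 'F_3 :=
  (x.1 + y.1, sign_nabla i k l c x.1 y.1 x.2 y.2).

Lemma zmod_loop (V : zmodType) : loop_law (+%R : V -> V -> V) 0.
Proof.
split; [split=> a b | exact: add0r | exact: addr0].
- by exists (b - a); split=> [|x <-]; rewrite ?(addrC a) ?subrK ?addrK.
- by exists (b - a); split=> [|x <-]; rewrite ?subrK ?addrK.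
Qed.

Lemma sign_ext_albert i k l c :
  i != 0 -> k != 0 -> l != 0 -> albert_ext_C3_C2 (sign_ext i k l c).
Proof.
move=> i0 k0 l0.
have q_nabla al be : quasigroup (sign_nabla i k l c al be).
  rewrite /sign_nabla; case: (al == 0); case: (be == 0).
  - by apply: (affine_quasigroup 1 1 0) => // a b; ring.
  - by apply: (affine_quasigroup i 1 0) => // a b; ring.
  - by apply: (affine_quasigroup 1 1 0) => // a b; ring.
  - exact: (affine_quasigroup k l c).
split; [exact: zmod_loop | exact: zmod_loop | |].
  exists (0, 0); split.
  - by have [qK _ _] := zmod_loop 'Z_2; apply: quasigroup_ext qK q_nabla.
  - by case=> al a; rewrite /sign_ext /sign_nabla /= !add0r mulr0 add0r if_same.
  - by case=> al a; rewrite /sign_ext /sign_nabla /= !addr0 if_same.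
exists (sign_nabla i k l c); split=> // al; rewrite /sign_nabla.
- by move=> a; rewrite eqxx mulr0 if_same add0r.
- by split=> a; rewrite eqxx if_same ?add0r ?addr0.
Qed.

(** Each [nabla] is affine. Over (0,1), the left identity 0 forces the constant 0 and the
    coefficient 1 of b, leaving [i] free; over (1,0), the two-sided identity forces a + b; over
    (1,1) nothing is forced. *)
Lemma albert_extP op :
    albert_ext_C3_C2 op ->
  exists i k l c, [/\ i != 0, k != 0, l != 0 & op =2 sign_ext i k l c].
Proof.
case=> _ _ _ [nabla [opE qn n00 n0 n1]].
have [i [j [c [i0 _ n01]]]] := F3_quasigroup_affine _ (qn 0 1).
have [i' [j' [c' [_ _ n10]]]] := F3_quasigroup_affine _ (qn 1 0).
have [k [l [d [k0 l0 n11]]]] := F3_quasigroup_affine _ (qn 1 1).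
exists i, k, l, d; split=> // -[al a] [be b]; rewrite opE /sign_ext; congr pair.
have [n10l n10r] := n1 1.
elim/Z2_ind: al; elim/Z2_ind: be; rewrite /sign_nabla //=.
- have c0 : c = 0 by have := n0 1 0; rewrite n01 !mulr0 !add0r.
  have j1 : j = 1 by have := n0 1 1; rewrite n01 c0 mulr0 mulr1 add0r addr0.
  by rewrite n01 c0 j1 mul1r addr0.
- have c'0 : c' = 0 by have := n10l 0; rewrite n10 !mulr0 !add0r.
  have i'1 : i' = 1 by have := n10r 1; rewrite n10 c'0 mulr0 mulr1 !addr0.
  have j'1 : j' = 1 by have := n10l 1; rewrite n10 c'0 mulr0 mulr1 add0r addr0.
  by rewrite n10 c'0 i'1 j'1 !mul1r addr0.
Qed.

(** * Isomorphisms between normal forms *)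

(** The condition on [c'] comes from the products (1,a)(1,b): s(ka + lb + c) must equal k(sa + t) +
    l(sb + t) + c'. *)
Lemma sign_ext_isomorphic i k l c c' s t :
    s != 0 -> c' = s * c - (k + l) * t ->
  loop_isomorphic (sign_ext i k l c) (sign_ext i k l c').
Proof.
move=> s0 c'E.
exists (fun x => (x.1, s * x.2 + (if x.1 == 0 then 0 else t))); split.
  exists (fun x => (x.1, (x.2 - (if x.1 == 0 then 0 else t)) / s)).
    by case=> al a /=; congr pair; field.
  by case=> al a /=; congr pair; field.
case=> al a [be b]; rewrite /sign_ext /=; congr pair.
by elim/Z2_ind: al; elim/Z2_ind: be; rewrite /sign_nabla /= ?c'E; ring.
Qed.

Lemma sign_extE i k l c a b :
  [/\ sign_ext i k l c (0, a) (0, b) = (0, a + b),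
      sign_ext i k l c (0, a) (1, b) = (1, i * a + b),
      sign_ext i k l c (1, a) (0, b) = (1, a + b)
    & sign_ext i k l c (1, a) (1, b) = (0, k * a + l * b + c)].
Proof. by split; congr pair; apply/eqP. Qed.

Lemma sign_ext_isomorphism_inv i k l c i' k' l' c' :
    loop_isomorphic (sign_ext i k l c) (sign_ext i' k' l' c') ->
  [/\ i = i', k = k', l = l'
    & exists s t, s != 0 /\ c' = s * c - (k + l) * t].
Proof.
case=> f [bij_f fM]; have inj_f := bij_inj bij_f.
have f00 a b : f (0, a + b) = sign_ext i' k' l' c' (f (0, a)) (f (0, b)).
  by rewrite -fM; have [-> _ _ _] := sign_extE i k l c a b.
have f01 a b : f (1, i * a + b) = sign_ext i' k' l' c' (f (0, a)) (f (1, b)).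
  by rewrite -fM; have [_ -> _ _] := sign_extE i k l c a b.
have f10 a b : f (1, a + b) = sign_ext i' k' l' c' (f (1, a)) (f (0, b)).
  by rewrite -fM; have [_ _ -> _] := sign_extE i k l c a b.
have f11 a b : f (0, k * a + l * b + c)
             = sign_ext i' k' l' c' (f (1, a)) (f (1, b)).
  by rewrite -fM; have [_ _ _ ->] := sign_extE i k l c a b.
have f0_1 a : (f (0, a)).1 = 0.
  (* As a = 4a in F_3, the first coordinate of f(0,a) is a multiple of 4 in Z_2, hence 0. *)
  have aE : a = (a + a) + (a + a) by apply/eqP; case: (a) => [[|[|[|]]]].
  by rewrite {1}aE !f00 /=; elim/Z2_ind: (f (0, a)).1; apply/eqP.
have f1_1 a : (f (1, a)).1 = 1.
  (* The first coordinate of f is constant on the elements (1,b). By surjectivity (1,0) has a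
     preimage, which cannot be of the form (0,b), so this constant is 1. *)
  have f1_const b : (f (1, b)).1 = (f (1, 0)).1.
    by rewrite -[b in LHS]add0r f10 /= f0_1 addr0.
  have [g _ gK] := bij_f; have := gK (1, 0); case: (g _) => al b.
  elim/Z2_ind: al => fx; first by have := f0_1 b; rewrite fx.
  by rewrite f1_const -(f1_const b) fx.
(* The restriction [h] to C_3 is additive and injective, so it is multiplication by [s]. As (1,a) =
   (1,0)(0,a), the map on the other coset has the same slope. *)
pose h a := (f (0, a)).2; pose t := (f (1, 0)).2; pose s := h 1.
have f0E a : f (0, a) = (0, h a) by rewrite [LHS]surjective_pairing f0_1.
have hD a b : h (a + b) = h a + h b.
  rewrite /h f00 !f0E.
  by have [-> _ _ _] := sign_extE i' k' l' c' (h a) (h b).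
have h0 : h 0 = 0 by apply: (addrI (h 0)); rewrite -hD !addr0.
have inj_h : injective h.
  by move=> a b eq_h; have /inj_f[] : f (0, a) = f (0, b) by rewrite !f0E eq_h.
have hE a : h a = s * a by rewrite (F3_inj_affine inj_h) h0 subr0 addr0.
have s0 : s != 0 by rewrite -h0 (inj_eq inj_h).
have f1E a : f (1, a) = (1, t + s * a).
  rewrite -[a in LHS]add0r f10 [f (1, 0)]surjective_pairing f1_1 f0E hE.
  by have [_ _ -> _] := sign_extE i' k' l' c' t (s * a).
have e01 a b : t + s * (i * a + b) = i' * (s * a) + (t + s * b).
  have := f01 a b; rewrite f0E !f1E.
  have [_ -> _ _] := sign_extE i' k' l' c' (h a) (t + s * b).
  by rewrite hE => /(congr1 snd).
have ii' : i = i'.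
  apply: (mulfI s0); transitivity (t + s * (i * 1 + 0) - t); first by ring.
  by rewrite e01; ring.
have e11 a b : s * (k * a + l * b + c)
               = k' * (t + s * a) + l' * (t + s * b) + c'.
  have := f11 a b; rewrite f0E !f1E.
  have [_ _ _ ->] := sign_extE i' k' l' c' (t + s * a) (t + s * b).
  by rewrite hE => /(congr1 snd).
(* Evaluating [e11] at (0,0), (1,0) and (0,1) compares the constants, then [k] with [k'] and [l]
   with [l']. *)
have cE : s * c = (k' + l') * t + c'.
  transitivity (s * (k * 0 + l * 0 + c)); first by ring.
  by rewrite e11; ring.
have kk' : k = k'.
  apply: (mulfI s0); transitivity (s * (k * 1 + l * 0 + c) - s * c).
    by ring.
  by rewrite e11 cE; ring.
have ll' : l = l'.
  apply: (mulfI s0); transitivity (s * (k * 0 + l * 1 + c) - s * c).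
    by ring.
  by rewrite e11 cE; ring.
by split=> //; exists s, t; rewrite cE kk' ll' addrAC subrr add0r.
Qed.

(** * The loops L in normal form *)

Lemma prime2_0 : prime2 0 = 0. Proof. exact/eqP. Qed.

Lemma prime2_1 : prime2 1 = 1. Proof. exact/eqP. Qed.

(** A parameter x in {0,1} encodes the sign 1 + x, as 2 = -1 in F_3. Thus theta records i, tau
    records l, and epsilon records the product k i. *)
Definition sgn_i (p : 'F_3 * 'F_3 * 'F_3 * 'F_3) := 1 + p.1.2.

Definition sgn_k (p : 'F_3 * 'F_3 * 'F_3 * 'F_3) := (1 + p.1.1.1) * (1 + p.1.2).

Definition sgn_l (p : 'F_3 * 'F_3 * 'F_3 * 'F_3) := 1 + p.1.1.2.

Lemma L_sign_ext p : L p =2 sign_ext (sgn_i p) (sgn_k p) (sgn_l p) p.2.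
Proof.
case: p => [[[e t] th] q] [al a] [be b]; rewrite /sign_ext /=; congr pair.
elim/Z2_ind: al; elim/Z2_ind: be; rewrite /sgn_i /sgn_k /sgn_l /sign_nabla /=;
  by rewrite ?prime2_0 ?prime2_1; ring.
Qed.

(** Normal forms are known only up to pointwise equality; this transfers isomorphisms without
    functional extensionality. *)
Lemma eq_loop_isomorphic {S T : Type} {opS opS' : S -> S -> S}
    {opT opT' : T -> T -> T} :
    opS =2 opS' -> opT =2 opT' ->
  loop_isomorphic opS opT -> loop_isomorphic opS' opT'.
Proof.
by move=> eS eT [f [bij_f fM]]; exists f; split=> // x y; rewrite -eS -eT.
Qed.

Lemma eq_albert {op op'} :
  op =2 op' -> albert_ext_C3_C2 op -> albert_ext_C3_C2 op'.
Proof.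
move=> eq_op [loopK loopN [one [[q1 q2] l1 r1]] [nabla [opE ? ? ? ?]]].
split=> //; last by exists nabla; split=> // x y; rewrite -eq_op.
exists one; split=> [|x|x]; rewrite -?eq_op //.
by split=> a b; [have [x [ax ux]] := q1 a b | have [x [ax ux]] := q2 a b];
   exists x; split=> [|y]; rewrite -eq_op // => /ux.
Qed.

(** * Nuclearity, associativity and commutativity *)

(** It suffices to test u = (0,1) against x = y = (1,0): the left nucleus gives ki + c = 1 + c, the
    right nucleus gives c + 1 = l + c. *)
Lemma sign_ext_nuclear i k l c :
  nuclear 0 (sign_ext i k l c) -> k * i = 1 /\ l = 1.
Proof.
move=> nuc; have [lnuc _ rnuc] := nuc 1; split.
  have /(congr1 snd) /= := lnuc (1, 0) (1, 0); rewrite /sign_nabla /= => e.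
  by apply: (addIr (l * 0 + c)); move: e; rewrite !(mulr0, mulr1, addr0, add0r).
have /(congr1 snd) /= := rnuc (1, 0) (1, 0); rewrite /sign_nabla /= => e.
by apply: (addIr c); move: e; rewrite !(mulr0, mulr1, addr0, add0r) addrC.
Qed.

Lemma sign_ext_nuclear_inv i k l c :
  i * i = 1 -> k = i -> l = 1 -> nuclear 0 (sign_ext i k l c).
Proof.
move=> ii -> -> a; split=> -[al x] [be y]; rewrite /sign_ext /=;
  (congr pair; first by rewrite ?(add0r, addr0));
  elim/Z2_ind: al; elim/Z2_ind: be; rewrite /sign_nabla /=; ring: ii.
Qed.

(** In the nuclear case the only obstruction is the cube of (1,0), which is (1, ic) or (1, c)
    according to the bracketing. *)
Lemma sign_ext_associativeP i k l c :
  i * i = 1 -> k = i -> l = 1 -> associative (sign_ext i k l c) <-> i * c = c.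
Proof.
move=> ii -> ->; split=> [opA | ic].
  have /(congr1 snd) /= := opA (1, 0) (1, 0) (1, 0).
  by rewrite /sign_nabla /= !(mulr0, add0r, addr0) => <-.
move=> [al x] [be y] [ga z]; rewrite /sign_ext /=.
congr pair; first exact: addrA.
by elim/Z2_ind: al; elim/Z2_ind: be; elim/Z2_ind: ga; rewrite /sign_nabla /=;
   ring: ii ic.
Qed.

Lemma sign_ext_commutativeP i k l c :
  commutative (sign_ext i k l c) <-> i = 1 /\ k = l.
Proof.
split=> [opC | [-> ->]].
  split.
    have /(congr1 snd) /= := opC (0, 1) (1, 0).
    by rewrite /sign_nabla /= mulr1 addr0 add0r.
  have /(congr1 snd) /= := opC (1, 1) (1, 0).
  by rewrite /sign_nabla /= !(mulr0, mulr1, addr0, add0r) => /addIr.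
case=> al x [be y]; rewrite /sign_ext /=; congr pair; first exact: addrC.
by elim/Z2_ind: al; elim/Z2_ind: be; rewrite /sign_nabla /=; ring.
Qed.

(** For u = (0,a) between (1,x) and (1,y), the two bracketings contribute ka and l(ia); hence the
    choice k = li. *)
Lemma sign_ext_middle_nuclear i l c :
  middle_nuclear 0 (sign_ext i (l * i) l c).
Proof.
move=> a [al x] [be y]; rewrite /sign_ext /= add0r addr0; congr pair.
by elim/Z2_ind: al; elim/Z2_ind: be; rewrite /sign_nabla /=; ring.
Qed.

(** * The two groups among the loops *)

Lemma L0000_cyclic :
  loop_isomorphic (L (0, 0, 0, 0)) (+%R : 'Z_6 -> 'Z_6 -> 'Z_6).
Proof.
(* 3 and 4 are the idempotents of Z/6. *)
exists (fun x : 'Z_2 * 'F_3 => inZp (3 * (x.1 : nat) + 4 * (x.2 : nat))).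
split.
  apply: inj_card_bij; last by rewrite card_prod !card_ord.
  case=> al a [be b] /eqP eq_f; apply/eqP; move: eq_f.
  by elim/Z2_ind: al; elim/Z2_ind: be; move: (F3_mem a) (F3_mem b);
     rewrite !inE => /or3P[] /eqP-> /or3P[] /eqP->.
case=> al a [be b]; apply/eqP.
by elim/Z2_ind: al; elim/Z2_ind: be; move: (F3_mem a) (F3_mem b);
   rewrite !inE => /or3P[] /eqP-> /or3P[] /eqP->.
Qed.

(** With a rotation x of order dividing 3 and a reflection y, the map is (al,a) to y^al x^a. Moving
    x^a past y^be multiplies a by 1 + be', which is the twist of L with theta = 1. *)
Lemma L0010_dihedral :
  loop_isomorphic (L (0, 0, 1, 0)) (fun x y : 'D_6 => (x * y)%g).
Proof.
have oD6 : #|[set: 'D_6]| = 6%N := @card_dihedral 3 isT.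
(* Applied to the group itself, the presentation yields generators satisfying its relations. *)
have := @Grp_dihedral 3 isT _ [set: 'D_6]%G.
rewrite homg_refl => /esym /existsP[[x y]] /=.
rewrite !xpair_eqE => /and4P[/eqP genxy /eqP x3 /eqP y2 /eqP xJy].
pose X (a : 'F_3) := (x ^+ (a : nat))%g.
pose Y (al : 'Z_2) := (y ^+ (al : nat))%g.
have XD a b : X (a + b) = (X a * X b)%g.
  by rewrite /X -expgD -[RHS](expg_mod _ x3).
have YD al be : Y (al + be) = (Y al * Y be)%g.
  by rewrite /Y -expgD -[RHS](expg_mod _ y2).
have XY a be : (X a * Y be = Y be * X ((1 + prime2 be) * a)%R)%g.
  elim/Z2_ind: be; first by rewrite prime2_0 addr0 mul1r mulg1 mul1g.
  have ->: (1 + prime2 1) * a = - a by apply/eqP; case: a => [[|[|[|]]]].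
  rewrite conjgC conjXg xJy; congr (_ * _)%g; apply: (mulgI (X a)).
  by rewrite -XD subrr expgVn mulgV.
pose f (u : 'Z_2 * 'F_3) := (Y u.1 * X u.2)%g.
(* Since y normalizes the subgroup generated by x, every element is a power of y times a power of x.
   Injectivity then follows because both sides have 6 elements. *)
have f_surj : f @: setT = setT.
  apply/setP => g; rewrite inE.
  have : g \in ([set: 'D_6] : {set _}) by rewrite inE.
  rewrite -genxy joingC norm_joinEl; last first.
    by rewrite norms_cycle xJy groupV cycle_id.
  case/mulsgP=> _ _ /cycleP[j ->] /cycleP[i ->] ->.
  apply/imsetP; exists (inZp j, inZp i) => //.
  by rewrite /f /X /Y /= (expg_mod _ y2) (expg_mod _ x3).
have card_eq : #|{: 'Z_2 * 'F_3}| = 6%N by rewrite card_prod !card_ord.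
have /imset_injP inj_f : #|f @: setT| == #|[set: 'Z_2 * 'F_3]|.
  by rewrite f_surj oD6 cardsT card_eq.
exists f; split.
  apply: inj_card_bij; first by move=> u v; apply: inj_f; rewrite inE.
  by rewrite -cardsT oD6 card_eq.
case=> al a [be b]; rewrite /f /= YD !mulgA -(mulgA (Y al) (X a)) XY.
by rewrite !mulgA -(mulgA _ (X _) (X b)) -XD; congr (_ * X _)%g; ring.
Qed.

(** * Classification by the list of twelve *)

Lemma twelve_signs p :
  p \in twelve -> [&& sgn_i p != 0, sgn_k p != 0 & sgn_l p != 0].
Proof.
apply/(allP (a := fun p => [&& sgn_i p != 0, sgn_k p != 0 & sgn_l p != 0])).
by vm_compute.
Qed.

Lemma twelve_albert p : p \in twelve -> albert_ext_C3_C2 (L p).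
Proof.
move=> /twelve_signs /and3P[i0 k0 l0].
apply: eq_albert (sign_ext_albert _ _ _ p.2 i0 k0 l0).
by move=> x y; rewrite L_sign_ext.
Qed.

Lemma twelve_exhaust i k l c :
    i != 0 -> k != 0 -> l != 0 ->
  exists p s t, [/\ p \in twelve, s != 0 & p.2 = s * c - (k + l) * t]
                /\ [/\ i = sgn_i p, k = sgn_k p & l = sgn_l p].
Proof.
move=> /F3_neq0_mem i0 /F3_neq0_mem k0 /F3_neq0_mem l0.
(* [sol] searches the entries with the prescribed signs for one whose constant is reached by some
   [s] and [t]. All signs and constants are then checked by computation. *)
pose sol i k l c := has (fun p => has (fun s => has (fun t =>
    p.2 == s * c - (k + l) * t) [:: 0; 1; -1]) [:: 1; -1])
  [seq p <- [seq p <- [seq p <- twelve | sgn_i p == i]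
    | sgn_k p == k] | sgn_l p == l].
have : all (fun i => all (fun k => all (fun l => all (sol i k l) [:: 0; 1; -1])
    [:: 1; -1]) [:: 1; -1]) [:: 1; -1 : 'F_3] by vm_compute.
move=> /allP /(_ _ i0) /allP /(_ _ k0) /allP /(_ _ l0) /allP /(_ _ (F3_mem c)).
case/hasP=> p; rewrite !mem_filter => /and4P[/eqP<- /eqP<- /eqP<- p12].
case/hasP=> s s1 /hasP[t _ /eqP pE]; exists p, s, t; do 2!split=> //.
by move: s1; rewrite !inE => /pred2P[] ->.
Qed.

Lemma twelve_classify op :
    albert_ext_C3_C2 op ->
  exists2 p, p \in twelve & loop_isomorphic op (L p).
Proof.
move=> /albert_extP[i [k [l [c [i0 k0 l0 opE]]]]].
have [p [s [t [[p12 s0 cE] [iE kE lE]]]]] := twelve_exhaust _ _ _ c i0 k0 l0.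
exists p => //; apply: (eq_loop_isomorphic (fun x y => esym (opE x y))
                          (fun x y => esym (L_sign_ext p x y))).
by rewrite -iE -kE -lE; apply: sign_ext_isomorphic s0 cE.
Qed.

Lemma twelve_distinct p p' :
    p \in twelve -> p' \in twelve ->
  loop_isomorphic (L p) (L p') -> p = p'.
Proof.
move=> p12 p'12 /(eq_loop_isomorphic (L_sign_ext p) (L_sign_ext p')).
move=> /sign_ext_isomorphism_inv.
case=> iE kE lE [s [t [/F3_neq0_mem s0 cE]]].
(* For two entries with equal signs, all possible [s] and [t] are tried; the constants match only
   when the entries coincide. *)
have : all (fun p => all (fun p' => all (fun s => all (fun t =>
      (p'.2 == s * p.2 - (sgn_k p + sgn_l p) * t) ==> (p == p'))
    [:: 0; 1; -1]) [:: 1; -1])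
  [seq p' <- [seq p' <- [seq p' <- twelve | sgn_i p == sgn_i p']
    | sgn_k p == sgn_k p'] | sgn_l p == sgn_l p']) twelve by vm_compute.
move=> /allP /(_ p p12) /allP /(_ p').
rewrite !mem_filter p'12 iE kE lE !eqxx -lE -kE => /(_ isT) /allP /(_ s s0).
by move=> /allP /(_ t (F3_mem t)); rewrite -cE eqxx => /eqP.
Qed.

Lemma associative_nuclear {K N : Type} (one : K)
    (op : K * N -> K * N -> K * N) :
  associative op -> nuclear one op.
Proof. by move=> opA a; split=> x y; rewrite opA. Qed.

Lemma twelve_nuclear p :
    p \in twelve -> nuclear 0 (L p) ->
  p \in [:: (0, 0, 0, 0); (0, 0, 1, 0); (0, 0, 1, 1)].
Proof.
move=> p12 nucp.
have nuc : nuclear 0 (sign_ext (sgn_i p) (sgn_k p) (sgn_l p) p.2).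
  move=> a; have [ln mn rn] := nucp a.
  by split=> x y; rewrite -!L_sign_ext; [apply: ln | apply: mn | apply: rn].
have [/eqP ki /eqP l1] := sign_ext_nuclear _ _ _ _ nuc.
suff /allP : all (mem [:: (0, 0, 0, 0); (0, 0, 1, 0); (0, 0, 1, 1)])
    [seq p <- twelve | (sgn_k p * sgn_i p == 1) && (sgn_l p == 1)].
  by apply; rewrite mem_filter ki l1.
by vm_compute.
Qed.

Lemma twelve_commutative p :
    p \in twelve -> commutative (L p) ->
  p \in [:: (0, 0, 0, 0); (1, 1, 0, 0)].
Proof.
move=> p12 Cp.
have C : commutative (sign_ext (sgn_i p) (sgn_k p) (sgn_l p) p.2).
  by move=> x y; rewrite -!L_sign_ext.
have [/eqP i1 /eqP kl] := (sign_ext_commutativeP _ _ _ _).1 C.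
suff /allP : all (mem [:: (0, 0, 0, 0); (1, 1, 0, 0)])
    [seq p <- twelve | (sgn_i p == 1) && (sgn_k p == sgn_l p)].
  by apply; rewrite mem_filter i1 kl.
by vm_compute.
Qed.

Theorem proposition16 :
  (* the twelve operations are loops, indeed Albert extensions *)
  (forall p, p \in twelve -> albert_ext_C3_C2 (L p)) /\
  (forall op : 'Z_2 * 'F_3 -> 'Z_2 * 'F_3 -> 'Z_2 * 'F_3,
     albert_ext_C3_C2 op ->
     exists2 p, p \in twelve & loop_isomorphic op (L p)) /\
  (forall p p', p \in twelve -> p' \in twelve -> p <> p' ->
     ~ loop_isomorphic (L p) (L p')) /\
  loop_isomorphic (L (0, 0, 0, 0)) (+%R : 'Z_6 -> 'Z_6 -> 'Z_6) /\
  loop_isomorphic (L (0, 0, 1, 0)) (fun x y : 'D_6 => (x * y)%g) /\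
  (~ associative (L (0, 0, 1, 1)) /\ nuclear 0 (L (0, 0, 1, 1))) /\
  (forall p, p \in twelve ->
     p <> (0, 0, 0, 0) -> p <> (0, 0, 1, 0) -> p <> (0, 0, 1, 1) ->
     ~ associative (L p) /\ ~ nuclear 0 (L p)) /\
  (forall p, p \in twelve ->
     (~ associative (L p) /\ commutative (L p) <-> p = (1, 1, 0, 0))) /\
  middle_nuclear 0 (L (1, 1, 0, 0)).
Proof.
have not_nuclear p : p \in twelve ->
    p <> (0, 0, 0, 0) -> p <> (0, 0, 1, 0) -> p <> (0, 0, 1, 1) ->
    ~ nuclear 0 (L p).
  move=> p12 n1 n2 n3 nuc; have := twelve_nuclear _ p12 nuc.
  by rewrite !inE => /or3P[] /eqP.
have not_assoc p : p \in twelve ->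
    p <> (0, 0, 0, 0) -> p <> (0, 0, 1, 0) -> p <> (0, 0, 1, 1) ->
    ~ associative (L p).
  (* Associativity would put every element in the nucleus, so it is excluded by non-nuclearity. *)
  move=> p12 n1 n2 n3 opA; apply: (not_nuclear p) => //.
  exact: associative_nuclear.
split; first exact: twelve_albert.
split; first exact: twelve_classify.
split; first by move=> p p' p12 p'12 neq iso; apply/neq/twelve_distinct.
split; first exact: L0000_cyclic.
split; first exact: L0010_dihedral.
split.
  pose p : 'F_3 * 'F_3 * 'F_3 * 'F_3 := (0, 0, 1, 1).
  have ii : sgn_i p * sgn_i p = 1 by apply/eqP.
  have ki : sgn_k p = sgn_i p by apply/eqP.
  have l1 : sgn_l p = 1 by apply/eqP.
  split=> [opA | a].
    have : associative (sign_ext (sgn_i p) (sgn_k p) (sgn_l p) p.2).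
      by move=> x y z; rewrite -!L_sign_ext.
    (* Here i = -1 and c = 1, so ic differs from c. *)
    by move/(sign_ext_associativeP _ _ _ _ ii ki l1)/eqP.
  have [ln mn rn] := sign_ext_nuclear_inv _ _ _ p.2 ii ki l1 a.
  by split=> x y; rewrite !(L_sign_ext p); [apply: ln | apply: mn | apply: rn].
split.
  move=> p p12 n1 n2 n3.
  by split; [apply: not_assoc | apply: not_nuclear].
split.
  move=> p p12; split=> [[nA Cp] | ->].
    move: (twelve_commutative _ p12 Cp); rewrite !inE => /pred2P[] // p0.
    (* The other commutative candidate, (0,0,0,0), is associative since its constant is 0. *)
    case: nA; rewrite p0 => x y z; rewrite !L_sign_ext; move: x y z.
    by apply/sign_ext_associativeP; apply/eqP.
  split; first by apply: not_assoc.
  move=> x y; rewrite !L_sign_ext; move: x y.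
  by apply/sign_ext_commutativeP; split; apply/eqP.
move=> a x y; rewrite !L_sign_ext.
(* Since epsilon = tau, [sgn_k] is by conversion the product of [sgn_l] and [sgn_i]. *)
exact: (sign_ext_middle_nuclear (sgn_i (1, 1, 0, 0)) (sgn_l (1, 1, 0, 0))).
Qed.
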